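(* For every chord diagram $D$, $$W_J(D)=J(\mathrm{LID}(D))\big|_{x_e=1},$$ where $W_J$ is the $0$-framed colored Jones weight system, $\mathrm{LID}(D)$ is the labeled intersection digraph of $D$, and $J$ is the partition function $$J(G)=\sum_{K\ \text{acceptable for } G}2^{\deg_4(K)}(\lambda+2)^{|V|-\deg_4(K)}\,x_K\,(-1)^{a(K)}$$ of a digraph $G=(V,A)$, evaluated with all arc variables $x_e$ set equal to $1$.
   Context: **Chord diagrams.** A chord diagram $D$ with $n$ chords consists of $2n$ distinct points on an oriented line, paired into $n$ chords. Each chord has a left and a right end-point. The chords are ordered $1,\dots,n$ from left to right according to their left end-points. Two distinct chords with left/right end-points $a_1<a_2$ and $b_1<b_2$ intersect if $a_1<b_1<a_2<b_2$ or $b_1<a_1<b_2<a_2$; the first is completely contained in the second if $b_1<a_1<a_2<b_2$. **The weight system $W_J$.** $W_J$ is the $0$-framed colored Jones ($\mathfrak{sl}_2$) weight system, normalized to equal $1$ on the diagram with no chords. It is given explicitly as follows, with $\lambda$ an indeterminate. The end-points of the chords of $D$ cut the line into segments $s_0,\dots,s_{2n}$ listed from left to right. Given a map $\sigma:\{\text{chords of }D\}\to\{-1,0,1\}$, define integers $m(s_i)$ by $m(s_0)=0$, $m(s_{i+1})=m(s_i)+\sigma(v)$ if the point between $s_i$ and $s_{i+1}$ is the left end-point of the chord $v$, and $m(s_{i+1})=m(s_i)-\sigma(v)$ if it is the right end-point of $v$. For a chord $v$ let $k$ (resp. $k'$) be the value of $m$ on the segment ending at the left (resp. right) end-point of $v$,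 and set $$w_\sigma(v)=\begin{cases}(k+1)(\lambda-k'+1)&\sigma(v)=1\\(\lambda-k+1)(k'+1)&\sigma(v)=-1\\\tfrac12\big((\lambda-2k)(\lambda-2k')-\lambda(\lambda+2)\big)&\sigma(v)=0.\end{cases}$$ Then $W_J(D)=\sum_\sigma\prod_v w_\sigma(v)$. **Labeled intersection digraph.** $\mathrm{LID}(D)$ has as vertices the chords $1,\dots,n$ of $D$. Its arcs are: an uncolored arc $(i,j)$ for each pair $i<j$ of intersecting chords; one loop (uncolored, regarded as leaving its vertex) at each vertex; and a red arc $(i,j)$ for each pair of chords such that $i$ is completely contained in $j$. **Acceptable objects.** Let $G=(V,A)$ be a finite digraph with one loop at each vertex (a loop is considered as an arc leaving its vertex), in which some non-loop arcs are colored red and the remaining arcs are uncolored; each arc $e$ carries a variable $x_e$. Write $(i,j)$ for an arc with initial vertex $i$ and terminal vertex $j$. A collection $K$ of arcs, each with a thickening of one of its two ends, is acceptable for $G$ if: - for a red arc $(i,j)$ of $G$, both the arc $(i,j)$ and its reversal $(j,i)$ may appear in $K$, but always thickened at $i$; for an uncolored arc $(i,j)$ of $G$, the arc $(i,j)$ with either end thickened may appear in $K$, but its reversal may not; - each vertex of $V$ is incident with $0$, $2$ or $4$ thickened arcs of $K$, where a loop contributes $2$ to the degree of its vertex; a loop is always thickened at its initial segment (it counts as one arc thickened at its vertex, leaving the vertex, and its other end counts as a non-thickened incidence); - exactly half of the arcs of $K$ incident with a vertex are thickened at that vertex; - if two arcs are thickened at a vertex, then one of them enters and the other leaves that vertex.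 $K$ is a set of thickened arcs: the same uncolored non-loop arc thickened at its two different ends gives two different possible elements of $K$ (both may occur), and likewise a red arc $(i,j)$ and its reversal (both thickened at $i$) are two different possible elements of $K$. **Notation.** $x_K=\prod_{e\in K}x_e$; $\deg_4(K)$ is the number of vertices incident with $4$ arcs of $K$ (loops counted twice); $a(K)$ is the number of arcs of $K$ whose initial segment is thickened (orientation in $K$, so for a reversed red arc the reversed orientation is used). *)

(* Defs.v *)
From HB Require Import structures.
From mathcomp Require Import all_boot all_order all_algebra.
From mathcomp.multinomials Require Export mpoly.

Set Implicit Arguments.
Unset Strict Implicit.
Unset Printing Implicit Defensive.

Import Order.TTheory GRing.Theory Num.Theory.
Local Open Scope ring_scope.

(* The 2n points on the oriented line are numbered 0, ..., 2n-1 from left to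
   right.  The first three axioms make the 2n end-points pairwise distinct, so
   that every point is an end-point of exactly one chord; lft_homo also says
   that the chords are numbered by their left end-points. *)
Record chord_diagram (n : nat) := ChordDiagram {
  lft : 'I_n -> 'I_(n.*2);
  rgt : 'I_n -> 'I_(n.*2);
  lft_homo : forall i j : 'I_n, (i < j)%N -> (lft i < lft j)%N;
  rgt_inj : injective rgt;
  lft_neq_rgt : forall i j : 'I_n, lft i != rgt j;
  lft_lt_rgt : forall i : 'I_n, (lft i < rgt i)%N
}.

Section Chords.
Variables (n : nat) (D : chord_diagram n).

Definition intersecting (i j : 'I_n) : bool :=
  [&& lft D i < lft D j, lft D j < rgt D i & rgt D i < rgt D j]%N
  || [&& lft D j < lft D i, lft D i < rgt D j & rgt D j < rgt D i]%N.

Definition contained (i j : 'I_n) : bool :=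
  [&& lft D j < lft D i, lft D i < rgt D i & rgt D i < rgt D j]%N.

End Chords.

Section WeightSystem.
Variables (n : nat) (D : chord_diagram n).

(* The elements 0, 1, 2 of 'I_3 encode the values -1, 0, 1 of sigma. *)
Definition state := {ffun 'I_n -> 'I_3}.

Definition sigma (s : state) (v : 'I_n) : int := (s v)%:Z - 1.

(* Value of m on the segment s_i.  The point between s_i and s_(i+1) is the
   point number i, so exactly one of the two sums below has a term, and that
   term is unique. *)
Fixpoint seg (s : state) (i : nat) : int :=
  if i is i'.+1 then
    seg s i' + \sum_(v < n | lft D v == i' :> nat) sigma s v
             - \sum_(v < n | rgt D v == i' :> nat) sigma s v
  else 0.

(* The indeterminate lambda is 'X in {poly rat}. *)
Definition chord_weight (s : state) (v : 'I_n) : {poly rat} :=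
  let k : {poly rat} := (seg s (lft D v))%:~R in
  let k' : {poly rat} := (seg s (rgt D v))%:~R in
  if sigma s v == 1 then (k + 1) * ('X - k' + 1)
  else if sigma s v == -1 then ('X - k + 1) * (k' + 1)
  else 2%:R^-1 *: (('X - 2%:R * k) * ('X - 2%:R * k') - 'X * ('X + 2%:R)).

Definition WJ : {poly rat} :=
  \sum_(s : state) \prod_(v < n) chord_weight s v.

End WeightSystem.

Record labeled_digraph := LabeledDigraph {
  vertex : finType;
  arc : finType;
  init : arc -> vertex;
  term : arc -> vertex;
  red : pred arc;
  one_loop : forall v, #|[set e | (init e == v) && (term e == v)]| = 1%N;
  red_nonloop : forall e, red e -> init e != term e
}.

Section PartitionFunction.
Variable G : labeled_digraph.

(* ((e, r), t) is the arc e, taken with its own orientation if r = false and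
   reversed if r = true, and thickened at its initial segment (for the
   orientation so obtained) if t = true, at its terminal one if t = false. *)
Definition thick_arc := (arc G * bool * bool)%type.

Definition base (k : thick_arc) : arc G := k.1.1.
Definition reversed (k : thick_arc) : bool := k.1.2.
Definition thick_init (k : thick_arc) : bool := k.2.

Definition source (k : thick_arc) : vertex G :=
  if reversed k then term (base k) else init (base k).
Definition target (k : thick_arc) : vertex G :=
  if reversed k then init (base k) else term (base k).
Definition thick_vertex (k : thick_arc) : vertex G :=
  if thick_init k then source k else target k.

Definition allowed (k : thick_arc) : bool :=
  if red (base k) then thick_vertex k == init (base k)
  else ~~ reversed k && ((init (base k) == term (base k)) ==> thick_init k).

Definition degree (K : {set thick_arc}) (v : vertex G) : nat :=
  (\sum_(k in K) ((source k == v) + (target k == v)))%N.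

Definition thick_at (K : {set thick_arc}) (v : vertex G) : {set thick_arc} :=
  [set k in K | thick_vertex k == v].

(* In the last clause, an arc thickened at v leaves v if it is thickened at its
   initial segment and enters v otherwise; a loop, being thickened at its
   initial segment, leaves. *)
Definition acceptable (K : {set thick_arc}) : bool :=
  [&& [forall k in K, allowed k],
      [forall v, degree K v \in [:: 0; 2; 4]%N],
      [forall v, (#|thick_at K v|.*2 == degree K v)%N]
    & [forall v, forall k1 in thick_at K v, forall k2 in thick_at K v,
         (k1 != k2) ==> (thick_init k1 != thick_init k2)]].

Definition deg4 (K : {set thick_arc}) : nat :=
  #|[set v | degree K v == 4%N]|.

Definition init_count (K : {set thick_arc}) : nat :=
  #|[set k in K | thick_init k]|.

(* Polynomials in the variables x_e, one for each arc e of G, with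
   coefficients in the polynomials in lambda = 'X.  A reversed arc carries the
   variable of the arc of G it comes from. *)
Definition arc_var (e : arc G) : {mpoly {poly rat}[#|{: arc G}|]} :=
  'X_(enum_rank e).

Definition J : {mpoly {poly rat}[#|{: arc G}|]} :=
  \sum_(K : {set thick_arc} | acceptable K)
    (2%:R ^+ deg4 K * ('X + 2%:R) ^+ (#|{: vertex G}| - deg4 K))%:MP
    * (\prod_(k in K) arc_var (base k))
    * (-1) ^+ init_count K.

End PartitionFunction.

Section LID.
Variables (n : nat) (D : chord_diagram n).

(* The three cases are mutually exclusive, since contained i j forces j < i. *)
Definition is_LID_arc (p : 'I_n * 'I_n) : bool :=
  [|| p.1 == p.2, (p.1 < p.2)%N && intersecting D p.1 p.2
    | contained D p.1 p.2].

Definition LID_arc : finType := {p : 'I_n * 'I_n | is_LID_arc p}.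

Definition LID_init (e : LID_arc) : 'I_n := (val e).1.
Definition LID_term (e : LID_arc) : 'I_n := (val e).2.
Definition LID_red (e : LID_arc) : bool :=
  contained D (LID_init e) (LID_term e).

Lemma LID_one_loop (v : 'I_n) :
  #|[set e | (LID_init e == v) && (LID_term e == v)]| = 1%N.
Proof.
have Hv : is_LID_arc (v, v) by rewrite /is_LID_arc eqxx.
rewrite -(cards1 (exist _ (v, v) Hv : LID_arc)); apply: eq_card => e.
by rewrite !inE -val_eqE /LID_init /LID_term; case: e => -[a b] ?.
Qed.

Lemma LID_red_nonloop (e : LID_arc) : LID_red e -> LID_init e != LID_term e.
Proof.
by rewrite /LID_red => /and3P[+ _ _]; apply: contraTneq => ->; rewrite ltnn.
Qed.

Definition LID : labeled_digraph :=
  LabeledDigraph LID_one_loop LID_red_nonloop.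

End LID.

(* Main.v *)
Require Import Defs.
From HB Require Import structures.
From mathcomp Require Import all_boot all_order all_algebra zify ring.

(* Both sides are vacuum expectations of words in the Weyl algebra generated by
   a variable m and d = d/dm, read along the line: each end-point of a chord
   acts on polynomials in m, the word is applied to 1 and evaluated at m = 0.

   On the basis m^k / k! the operators E = m, F = (lambda+2) d - d^2 m and
   H = 2 d m - (lambda+2) act with the coefficients k+1, lambda-k+1 and
   2k-lambda that occur in w_sigma, so W_J is the sum of all words in which each
   chord carries E..F, F..E, (1/2) H..H or -(1/2) lambda (lambda+2) 1..1.

   On the other side, an acceptable K amounts to letting every end-point pick at
   most one chord over it (an arc thickened at its initial, resp. terminal,
   segment is a pick made at the right, resp. left, end-point, and a loop is a
   chord picking itself), each chord being picked as often as it picks.  Hence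
   J is a coefficient of a product over end-points of sums of variables X_u over
   the chords u covering it.  Such a product is the word in which chord u shifts
   m by -X_u and X_u at its two ends, and Taylor expansion of the shifts yields
   the same words in the operators d^i m^e / i!, with the same coefficients. *)

Set Implicit Arguments.
Unset Strict Implicit.
Unset Printing Implicit Defensive.

Import GRing.Theory Num.Theory.
Local Open Scope ring_scope.

(** * Words in sums of operators *)

(* Only the values of c on s matter on the left; that the others sum to 1 lets
   the product on the right range over the whole type during the induction. *)
Lemma foldl_sum_expand (R : comNzRingType) (V : lmodType R) (P I : finType)
    (M : P -> I -> {linear V -> V}) (s : seq P) (c : P -> I -> R) (f : V) :
  uniq s -> (forall x, x \notin s -> \sum_a c x a = 1) ->
  foldl (fun g x => \sum_a c x a *: M x a g) f s =
  \sum_(h : {ffun P -> I})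
     (\prod_x c x (h x)) *: foldl (fun g x => M x (h x) g) f s.
Proof.
elim: s c f => [|x s IHs] c f /=.
  move=> _ c1; rewrite -scaler_suml -(bigA_distr_bigA c) big1 ?scale1r //.
case/andP=> xs us c1.
pose O g y := \sum_a c y a *: M y a g.
have O_lin t (K : I -> V) (k : I -> R) :
    foldl O (\sum_a k a *: K a) t = \sum_a k a *: foldl O (K a) t.
  elim: t K => //= y t IHt K; rewrite -IHt; congr foldl.
  rewrite /O; under [RHS]eq_bigr => a _ do rewrite scaler_sumr.
  rewrite [RHS]exchange_big; apply: eq_bigr => b _ /=.
  rewrite linear_sum scaler_sumr; apply: eq_bigr => a _.
  by rewrite linearZ !scalerA mulrC.
rewrite -/O O_lin.
(* Once [M x a] is applied at x, the coefficients at x become a Kronecker delta at a. They sum to 1,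
   as the induction hypothesis asks of x, which is not in s. *)
pose c' a y b := if y == x then (b == a)%:R else c y b.
have step a : foldl O (M x a f) s = \sum_(h : {ffun P -> I})
     (\prod_y c' a y (h y)) *: foldl (fun g y => M y (h y) g) (M x a f) s.
  rewrite -IHs //; last first.
    move=> y ys; rewrite /c'; case: eqVneq => [_|yx].
      by rewrite (bigD1 a) //= eqxx big1 ?addr0 // => b /negPf->.
    by apply: c1; rewrite inE negb_or yx.
  (* Induction on a list t contained in s: [c'] and [c] agree there, as x is not in s. *)
  have: {subset s <= s} by [].
  elim: {1 3 4}s (M x a f) => //= y t IHt g yts.
  rewrite IHt; last by move=> z zt; rewrite yts ?inE ?zt ?orbT.
  congr foldl; apply: eq_bigr => b _; rewrite /c'.
  by case: eqVneq => // yx; rewrite -yx yts ?mem_head in xs.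
under [LHS]eq_bigr => a _ do rewrite step scaler_sumr.
rewrite [LHS]exchange_big; apply: eq_bigr => h _ /=.
rewrite (bigD1 (h x)) //= [X in _ + X]big1 ?addr0 => [|a ah].
  rewrite scalerA !(bigD1 (P := xpredT) x) //= {1}/c' !eqxx mul1r.
  congr (_ * _ *: _); apply: eq_bigr => y /negPf yx.
  by rewrite /c' yx.
by rewrite (bigD1 x) //= /c' eqxx eq_sym (negPf ah) mul0r scale0r scaler0.
Qed.

(** * End-points along the line and signed partial sums *)

Definition pos (n : nat) (D : chord_diagram n) (x : 'I_n * bool) : nat :=
  if x.2 then rgt D x.1 else lft D x.1.

Lemma pos_inj n (D : chord_diagram n) : injective (pos D).
Proof.
have lft_inj : injective (lft D).
  move=> i j lij; apply/val_inj/eqP; rewrite eqn_leq.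
  by apply/andP; split; rewrite leqNgt; apply/negP => /(lft_homo D);
    rewrite lij ltnn.
case=> [i []] [j []]; rewrite /pos /= => /val_inj E.
- by rewrite (rgt_inj E).
- by have := lft_neq_rgt D j i; rewrite E eqxx.
- by have := lft_neq_rgt D i j; rewrite E eqxx.
- by rewrite (lft_inj _ _ E).
Qed.

Lemma pos_ltn n (D : chord_diagram n) x : (pos D x < n.*2)%N.
Proof. by rewrite /pos; case: x.2; apply: ltn_ord. Qed.

(** [pos] injects 2n end-points into 2n positions, so it is a bijection, and its inverse lists them
    in order. *)
Lemma endpoints_sorted n (D : chord_diagram n) :
  exists s : seq ('I_n * bool),
    [/\ uniq s, forall x, x \in s & map (pos D) s = iota 0 n.*2].
Proof.
pose p x := Ordinal (pos_ltn D x).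
have p_inj : injective p by move=> x y /(congr1 val) /(@pos_inj n D).
have [q pK qK] : bijective p.
  by apply: inj_card_bij => //; rewrite card_prod card_bool !card_ord muln2.
exists (map q (enum 'I_(n.*2))); split.
- by rewrite map_inj_uniq ?enum_uniq //; apply: can_inj qK.
- by move=> x; rewrite -(pK x) map_f // mem_enum.
rewrite -map_comp -val_enum_ord; apply: eq_map => i /=.
by have /(congr1 val) := qK i.
Qed.

(* Non-strict at the right end-point only, so that a chord covers its own right
   end-point: this is what accounts for loops. *)
Definition live n (D : chord_diagram n) (x : 'I_n * bool) (u : 'I_n) : bool :=
  (lft D u < pos D x <= rgt D u)%N.

(** Common form of the heights m(s_i), for y = [sigma s], and of the sums of variables X_u on the J
    side. *)
Definition psum n (D : chord_diagram n) (Z : zmodType) (y : 'I_n -> Z) (i : nat)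
    : Z :=
  \sum_(u | (lft D u < i)%N) y u - \sum_(u | (rgt D u < i)%N) y u.

Lemma psum0 n (D : chord_diagram n) (Z : zmodType) (y : 'I_n -> Z) :
  psum D y 0 = 0.
Proof. by rewrite /psum !big_pred0 ?subr0. Qed.

Lemma psum_end n (D : chord_diagram n) (Z : zmodType) (y : 'I_n -> Z) :
  psum D y n.*2 = 0.
Proof.
by apply/eqP; rewrite subr_eq0; apply/eqP/eq_bigl => u; rewrite !ltn_ord.
Qed.

(** A chord that ends before x also starts before x, so its two terms cancel. *)
Lemma psum_live n (D : chord_diagram n) (Z : zmodType) (y : 'I_n -> Z) x :
  psum D y (pos D x) = \sum_(u | live D x u) y u.
Proof.
apply/eqP; rewrite subr_eq (bigID (fun u => pos D x <= rgt D u)%N) /=.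
apply/eqP; congr (_ + _); apply: eq_bigl => u; rewrite -ltnNge.
by apply/andb_idl => /(ltn_trans _); apply; apply: lft_lt_rgt.
Qed.

Lemma psumS n (D : chord_diagram n) (Z : zmodType) (y : 'I_n -> Z) i :
  psum D y i.+1 = psum D y i + \sum_(v < n | lft D v == i :> nat) y v
                 - \sum_(v < n | rgt D v == i :> nat) y v.
Proof.
have H (p : 'I_n -> nat) : \sum_(u | (p u < i.+1)%N) y u =
    \sum_(u | (p u < i)%N) y u + \sum_(u | p u == i) y u.
  rewrite (bigID (fun u => p u < i)%N) /=; congr (_ + _); apply: eq_bigl => u.
    by rewrite ltnS andb_idl // => /ltnW.
  by rewrite ltnS -leqNgt eqn_leq.
by rewrite /psum !H opprD addrACA addrA.
Qed.

Lemma psum_posS n (D : chord_diagram n) (Z : zmodType) (y : 'I_n -> Z) x :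
  psum D y (pos D x).+1 = psum D y (pos D x) + (if x.2 then - y x.1 else y x.1).
Proof.
have side b : \sum_(v | pos D (v, b) == pos D x) y v =
    if x.2 == b then y x.1 else 0.
  have E v : (pos D (v, b) == pos D x) = ((v == x.1) && (x.2 == b)).
    by case: x => w c; rewrite (inj_eq (@pos_inj _ D)) xpair_eqE [b == c]eq_sym.
  rewrite (eq_bigl _ _ E); case: eqP => _.
    by rewrite (eq_bigl (pred1 x.1)) ?big_pred1_eq // => v; rewrite andbT.
  by rewrite big_pred0 // => v; rewrite andbF.
rewrite psumS -addrA; congr (_ + _); have := side false; have := side true.
by rewrite /pos /= => -> ->; case: x.2; rewrite ?sub0r ?subr0.
Qed.

Lemma seg_psum n (D : chord_diagram n) (s : state n) i :
  seg D s i = psum D (sigma s) i.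
Proof. by elim: i => [|i IHi] /=; rewrite ?psum0 // psumS IHi. Qed.

(** Invariant for reading the line: [A i] is the state on reaching the point number i. *)
Lemma foldl_pos n (D : chord_diagram n) (T : Type) (O : T -> 'I_n * bool -> T)
    (A : nat -> T) (s : seq ('I_n * bool)) :
  (forall x, O (A (pos D x)) x = A (pos D x).+1) ->
  map (pos D) s = iota 0 n.*2 -> foldl O (A 0%N) s = A n.*2.
Proof.
move=> OA.
have fold i k : map (pos D) s = iota i k -> foldl O (A i) s = A (i + k)%N.
  elim: s i k => [|x s IHs] i [|k] //=; first by rewrite addn0.
  by case=> <- /IHs; rewrite OA addSnnS => ->.
by move/fold.
Qed.

(** * The operators d^i m^e / i! and their words *)

(** Divided derivatives make sense over every [R], in particular over multivariate polynomials. *)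
Definition ladder (R : comNzRingType) (e : bool) (i : nat) (f : {poly R}) :
  {poly R} := ('X^e * f)^`N(i).

Lemma ladder_is_linear (R : comNzRingType) (e : bool) (i : nat) :
  linear (@ladder R e i).
Proof.
by move=> c f g; rewrite /ladder mulrDr -scalerAr nderivnD nderivnZ.
Qed.

HB.instance Definition _ (R : comNzRingType) (e : bool) (i : nat) :=
  GRing.isLinear.Build R {poly R} {poly R} _ (@ladder R e i)
    (@ladder_is_linear R e i).

Definition ladder_word (R : comNzRingType) (P : Type) (s : seq P)
    (e : P -> bool) (i : P -> nat) : R :=
  (foldl (fun f x => ladder (e x) (i x) f) 1 s)`_0.

(** Shows in [count_picks] that a word over multivariate polynomials is a constant, which can be
    taken out of a coefficient. *)
Lemma ladder_word_map (R S : comNzRingType) (phi : {rmorphism R -> S})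
    (P : Type) (s : seq P) e i :
  phi (ladder_word R s e i) = ladder_word S s e i.
Proof.
have fold f : map_poly phi (foldl (fun g x => ladder (e x) (i x) g) f s) =
    foldl (fun g x => ladder (e x) (i x) g) (map_poly phi f) s.
  elim: s f => //= x s IHs f; rewrite IHs; congr foldl.
  by rewrite /ladder -nderivn_map rmorphM /= map_polyXn.
by rewrite /ladder_word -coef_map fold rmorph1.
Qed.

Lemma ladderXn (R : comNzRingType) e i j :
  ladder e i ('X^j : {poly R}) = 'C(e + j, i)%:R *: 'X^(e + j - i).
Proof. by rewrite /ladder -exprD nderivnXn scaler_nat. Qed.

(** * W_J as a sum of words *)

(* m^k / k!, which is 0 for k < 0: paths through negative values of m have
   weight 0. *)
Definition divpow (k : int) : {poly {poly rat}} :=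
  if k is Posz j then (j`!%:R^-1)%:P *: 'X^j else 0.

(* Coefficients on the operators d^i m^e / i! of E (t = 1), F (t = -1) and, for
   t = 0, of the identity or H according to u. *)
Definition endpoint_coef (u : bool) (t : int) (e : bool) (i : nat) :
    {poly rat} :=
  if t == 1 then (e && (i == 0%N))%:R
  else if t == -1 then
    if e then - (i == 2%N)%:R * 2%:R else (i == 1%N)%:R * ('X + 2%:R)
  else if u then (~~ e && (i == 0%N))%:R
  else if e then (i == 1%N)%:R * 2%:R else - (i == 0%N)%:R * ('X + 2%:R).

Definition endpoint_weight (u : bool) (t k : int) : {poly rat} :=
  if t == 1 then k%:~R + 1
  else if t == -1 then 'X - k%:~R + 1
  else if u then 1 else 2%:R * k%:~R - 'X.

(** E, F and H involve derivatives of order at most 2; the larger index type is the one used for the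
    Taylor expansion on the J side. *)
Lemma sum_bool_ord (V : nmodType) N (F : bool -> nat -> V) :
  (forall e i, (2 < i)%N -> F e i = 0) ->
  \sum_(a : bool * 'I_N.+3) F a.1 a.2 =
    (F true 0%N + F true 1%N + F true 2%N) +
    (F false 0%N + F false 1%N + F false 2%N).
Proof.
move=> F0; have H e : \sum_(i < N.+3) F e i = F e 0%N + F e 1%N + F e 2%N.
  rewrite !big_ord_recl big1 ?addr0 ?addrA // => i _.
  by rewrite F0.
by rewrite -(pair_bigA _ (fun e (i : 'I_N.+3) => F e i)) /= big_bool /= !H.
Qed.

Lemma endpoint_op N u (t k : int) : t \in [:: -1; 0; 1] ->
  \sum_(a : bool * 'I_N.+3)
     endpoint_coef u t a.1 a.2 *: ladder a.1 a.2 (divpow k)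
  = endpoint_weight u t k *: divpow (k + t).
Proof.
rewrite !inE => tP; rewrite (@sum_bool_ord _ _ (fun e i =>
  endpoint_coef u t e i *: ladder e i (divpow k))); last first.
  move=> e i i2; rewrite /endpoint_coef.
  have [-> -> ->] : [/\ i == 0%N = false, i == 1%N = false & i == 2%N = false].
    by case: i i2 => [|[|[|]]].
  by rewrite !andbF oppr0 !mul0r; do !case: ifP => _; rewrite ?scale0r.
(* For k < 0 the left side is 0. So is the right side: k + t is again negative, unless k = -1 and t
   = 1, and then the weight k + 1 is 0. *)
case: k => [j|j]; last first.
  rewrite {1 2 3 4 5 6}/divpow !linear0 ?scaler0 ?addr0.
  case/or3P: tP => /eqP->; rewrite /endpoint_weight /=.
  - by case: j => [|j]; rewrite ?scaler0.
  - by case: j => [|j]; rewrite ?scaler0.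
  - case: j => [|j]; rewrite ?scaler0 //.
    by rewrite NegzE mulrNz mulr1z addNr scale0r.
have divpowS m : (m`!%:R^-1)%:P = m.+1%:R * (m.+1`!%:R^-1)%:P :> {poly rat}.
  rewrite -polyC_natr -polyCM factS natrM invfM mulrA divff ?mul1r //.
  by rewrite pnatr_eq0.
rewrite [divpow j]/= !linearZ /= !ladderXn /=.
rewrite /endpoint_coef /endpoint_weight.
case/or3P: tP => /eqP-> /=.
- rewrite !(mul0r, oppr0, scale0r, scaler0, add0r, addr0) mul1r mulN1r.
  (* At k = 0 both sides vanish: d and d^2 m kill 1, and [divpow (-1)] is 0. *)
  case: j => [|j]; first by rewrite !bin0n bin_small // !scale0r !scaler0 addr0.
  have -> : j.+1%:Z - 1 = j%:Z by rewrite -addn1 PoszD addrK.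
  rewrite /divpow !add0n !add1n !subSS !subn0 (divpowS j) !scalerA -scalerDl.
  move: (_^-1)%:P => c.
  (* For k = j+1 what remains is (lambda+2)(j+1) - 2 C(j+2,2) = (lambda-j)(j+1). *)
  congr (_ *: _); have /(congr1 (fun m => m%:R : {poly rat})) :=
    mul_bin_diag j.+2 1.
  rewrite bin1 !natrM => /= binE; rewrite -pmulrn.
  rewrite -mulrA mulNr -binE; ring.
- rewrite !addn0; case: u;
    rewrite !(mul0r, mul1r, oppr0, scale0r, scaler0, add0r, addr0).
    by rewrite bin0 !scale1r subn0.
  rewrite add1n subn1 bin1 bin0 subn0 !scalerA -scalerDl; congr (_ *: _).
  rewrite -pmulrn; move: (_^-1)%:P => c; ring.
rewrite !(scale0r, scaler0, addr0) !scale1r subn0 addn1 add1n.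
rewrite (divpowS j) scalerA; congr (_ *: _).
rewrite -pmulrn; move: (_^-1)%:P => c; ring.
Qed.

(** The flag [u] splits the weight for sigma = 0 into its H..H part ([false]) and its 1..1 part
    ([true]). *)
Definition chord_coef (u : bool) (t : int) : {poly rat} :=
  if t == 0 then if u then - (2%:R^-1)%:P * ('X * ('X + 2%:R)) else (2%:R^-1)%:P
  else (~~ u)%:R.

Lemma chord_weight_endpoints n (D : chord_diagram n) (s : state n) v :
  chord_weight D s v = \sum_u chord_coef u (sigma s v) *
    (endpoint_weight u (sigma s v) (seg D s (lft D v)) *
     endpoint_weight u (- sigma s v) (seg D s (rgt D v))).
Proof.
rewrite big_bool /= /chord_weight /chord_coef /endpoint_weight /sigma.
case: (s v) => [[|[|[|]]] //= _]; rewrite ?mul0r ?mul1r ?add0r //.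
rewrite -mul_polyC; ring.
Qed.

(* Coefficient of a pair of operators d^i1 m^e1 / i1!, d^i2 m^e2 / i2! at the
   two ends of a chord, common to W_J and J. *)
Definition pair_coef (e1 e2 : bool) (i1 i2 : nat) : {poly rat} :=
  (i1 + i2 == e1 + e2)%N%:R * (-1) ^+ (e2 + i1)
  * (if e1 && e2 then 2%:R else 'X + 2%:R).

(** In E..F + F..E + (1/2) H..H - (1/2) lambda (lambda+2) 1..1 every surviving term has as many d as
    m. The two constants (1/2)(lambda+2)^2 and -(1/2) lambda (lambda+2) add up to lambda+2. *)
Lemma pair_coefE e1 e2 i1 i2 :
  \sum_(a : 'I_3) \sum_u chord_coef u (a%:Z - 1) *
    (endpoint_coef u (a%:Z - 1) e1 i1 * endpoint_coef u (- (a%:Z - 1)) e2 i2)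
  = pair_coef e1 e2 i1 i2.
Proof.
have half : (2%:R^-1)%:P * 2%:R = 1 :> {poly rat}.
  by rewrite -polyC_natr -polyCM mulVf.
rewrite !big_ord_recl big_ord0 !big_bool /chord_coef /endpoint_coef /pair_coef.
move: (2%:R^-1)%:P half => h half.
(* [ring] does not know that h is 1/2, so where needed the right side is multiplied by h * 2. *)
have halfM c : c = h * 2%:R * c by rewrite half mul1r.
case: e1; case: e2; case: i1 => [|[|[|i1]]]; case: i2 => [|[|[|i2]]];
  rewrite ?addSn ?addnS /= ?mulr0 ?mul0r ?oppr0 ?mul0r ?mulr0 ?addr0;
  by [ring | rewrite [RHS]halfM; ring].
Qed.

Definition endpoint_step n (s : state n) (x : 'I_n * bool) : int :=
  if x.2 then - sigma s x.1 else sigma s x.1.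

Lemma prod_endpoints n (R : comNzRingType) (F : 'I_n * bool -> R) :
  \prod_x F x = \prod_v (F (v, false) * F (v, true)).
Proof.
rewrite (eq_bigr (fun x => F (x.1, x.2))) => [|[] //].
rewrite -(pair_bigA _ (fun v b => F (v, b))) /=.
by apply: eq_bigr => v _; rewrite big_bool /= mulrC.
Qed.

Lemma endpoint_step_in n (s : state n) x : endpoint_step s x \in [:: -1; 0; 1].
Proof.
by rewrite /endpoint_step /sigma; case: x.2; case: (s x.1) => [[|[|[|]]]].
Qed.

Lemma prod_pos_ltS n (D : chord_diagram n) (R : comNzRingType) F x :
  \prod_(y | (pos D y < (pos D x).+1)%N) F y =
  \prod_(y | (pos D y < pos D x)%N) F y * F x :> R.
Proof.
rewrite (bigD1 x) //= mulrC; congr (_ * _); apply: eq_bigl => y.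
by rewrite ltnS ltn_neqAle (inj_eq (@pos_inj _ D)) andbC.
Qed.

Lemma prod_endpoint_weight n (D : chord_diagram n) N (s : state n)
    (u : {ffun 'I_n -> bool}) t :
  uniq t -> (forall x, x \in t) -> map (pos D) t = iota 0 n.*2 ->
  \prod_x endpoint_weight (u x.1) (endpoint_step s x) (seg D s (pos D x)) =
  \sum_(h : {ffun 'I_n * bool -> bool * 'I_N.+3})
    (\prod_x endpoint_coef (u x.1) (endpoint_step s x) (h x).1 (h x).2)
    * ladder_word {poly rat} t (fun x => (h x).1) (fun x => (h x).2).
Proof.
move=> ut tP tpos.
pose w x := endpoint_weight (u x.1) (endpoint_step s x) (seg D s (pos D x)).
pose c x (a : bool * 'I_N.+3) :=
  endpoint_coef (u x.1) (endpoint_step s x) a.1 a.2.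
(* State before the point i: the weights collected so far times [divpow] of the height. The height
   is 0 at both ends of the line, where [divpow] is 1. *)
pose A i := \prod_(x | (pos D x < i)%N) w x *: divpow (seg D s i).
have c1 x : x \notin t -> \sum_a c x a = 1 by rewrite tP.
have := foldl_sum_expand
  (fun=> fun a : bool * 'I_N.+3 => @ladder {poly rat} a.1 a.2) 1 ut c1.
have A0 : A 0%N = 1 by rewrite /A big_pred0 //= scale1r fact0 invr1 scale1r.
rewrite -A0.
rewrite (foldl_pos (D := D)) //; last first.
  move=> x; rewrite /A !seg_psum.
  rewrite prod_pos_ltS; set m := \prod_(y | _) w y.
  under eq_bigr => a _ do rewrite linearZ /= scalerA [_ * m]mulrC -scalerA.
  rewrite -scaler_sumr endpoint_op ?endpoint_step_in // scalerA psum_posS.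
  by rewrite /w seg_psum.
move/(congr1 (fun p : {poly _} => p`_0)).
rewrite {1}/A seg_psum psum_end /= fact0 invr1 scale1r coefZ coefXn eqxx mulr1.
rewrite (eq_bigl predT) => [->|x]; last by rewrite pos_ltn.
rewrite coef_sum; apply: eq_bigr => h _; rewrite coefZ.
by rewrite /ladder_word A0.
Qed.

(** For a fixed choice [h] of operators the sums over sigma and over the flags factor over the
    chords, and [pair_coefE] evaluates each factor. *)
Lemma WJ_ladder n (D : chord_diagram n) N t :
  uniq t -> (forall x, x \in t) -> map (pos D) t = iota 0 n.*2 ->
  WJ D = \sum_(h : {ffun 'I_n * bool -> bool * 'I_N.+3})
    (\prod_v pair_coef (h (v, false)).1 (h (v, true)).1
                       (h (v, false)).2 (h (v, true)).2)
    * ladder_word {poly rat} t (fun x => (h x).1) (fun x => (h x).2).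
Proof.
move=> ut tP tpos; rewrite /WJ.
pose cf u s v (h : {ffun 'I_n * bool -> bool * 'I_N.+3}) : {poly rat} :=
  chord_coef u s * (endpoint_coef u s (h (v, false)).1 (h (v, false)).2 *
                    endpoint_coef u (- s) (h (v, true)).1 (h (v, true)).2).
have E s : \prod_v chord_weight D s v =
  \sum_(h : {ffun 'I_n * bool -> bool * 'I_N.+3})
    (\prod_v \sum_u cf u (sigma s v) v h)
    * ladder_word {poly rat} t (fun x => (h x).1) (fun x => (h x).2).
  under eq_bigr do rewrite chord_weight_endpoints.
  rewrite bigA_distr_bigA /=.
  transitivity (\sum_(u : {ffun 'I_n -> bool})
      \sum_h (\prod_v cf (u v) (sigma s v) v h)
      * ladder_word {poly rat} t (fun x => (h x).1) (fun x => (h x).2)).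
    apply: eq_bigr => u _; rewrite big_split /=.
    have -> : \prod_v (endpoint_weight (u v) (sigma s v) (seg D s (lft D v)) *
        endpoint_weight (u v) (- sigma s v) (seg D s (rgt D v))) =
      \prod_x endpoint_weight (u x.1) (endpoint_step s x) (seg D s (pos D x)).
      by rewrite prod_endpoints.
    rewrite (prod_endpoint_weight N _ _ ut tP tpos) mulr_sumr.
    by apply: eq_bigr => h _; rewrite prod_endpoints mulrA -big_split.
  rewrite exchange_big; apply: eq_bigr => h _ /=.
  by rewrite -mulr_suml bigA_distr_bigA.
under eq_bigr do rewrite E.
rewrite exchange_big; apply: eq_bigr => h _; rewrite -mulr_suml; congr (_ * _).
rewrite -(bigA_distr_bigA (fun v (a : 'I_3) => \sum_u cf u (a%:Z - 1) v h)).
by apply: eq_bigr => v _; rewrite pair_coefE.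
Qed.

(** * Taylor expansion and the number of picks *)

(** Taylor's formula: exp(c d) shifts m by c. *)
Lemma sum_nderivn_comp (R : comNzRingType) (f : {poly R}) c N :
  (size f <= N)%N -> \sum_(i < N) c ^+ i *: f^`N(i) = f \Po ('X + c%:P).
Proof.
move=> fN; rewrite /comp_poly (@nderiv_taylor_wide _ N) ?size_map_polyC //.
  apply: eq_bigr => i _; rewrite nderivn_map -rmorphXn -/(comp_poly 'X _).
  by rewrite comp_polyXr mulrC mul_polyC.
exact: mulrC.
Qed.

(** A factor m inserted at x undergoes the shifts at x and later. As all shifts sum to 0, these sum
    to [psum D y (pos D x)], the value of the factor at m = 0. *)
Lemma prod_psum_ladder n (D : chord_diagram n) (R : comNzRingType)
    (y : 'I_n -> R) (e : 'I_n * bool -> bool) t :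
  uniq t -> (forall x, x \in t) -> map (pos D) t = iota 0 n.*2 ->
  \prod_(x | e x) psum D y (pos D x) =
  \sum_(i : {ffun 'I_n * bool -> 'I_(n.*2.+3)})
    (\prod_x (if x.2 then y x.1 else - y x.1) ^+ i x)
    * ladder_word R t e (fun x => i x).
Proof.
move=> ut tP tpos; set N := n.*2.+3.
pose z x := if x.2 then y x.1 else - y x.1.
pose A i := \prod_(x | e x && (pos D x < i)%N)
  ('X - (psum D y i - psum D y (pos D x))%:P) : {poly R}.
have A0 : A 0%N = 1 by rewrite /A big_pred0 // => x; rewrite andbF.
have c1 x : x \notin t -> \sum_(i < N) z x ^+ i = 1 by rewrite tP.
have := foldl_sum_expand (fun x => fun i : 'I_N => @ladder R (e x) i) 1 ut c1.
rewrite -A0 (foldl_pos (D := D)) //; last first.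
  move=> x; rewrite sum_nderivn_comp; last first.
    (* At most 2n factors, and possibly one more m at x: the size is at most 2n + 2, below N. *)
    have sA : (size (A (pos D x)) <= n.*2.+1)%N.
      rewrite /A -big_filter size_prod_XsubC size_filter.
      apply: leq_ltn_trans (count_size _ _) _.
      rewrite ltnS /index_enum -enumT -cardT card_prod card_bool card_ord.
      by rewrite muln2.
    apply: leq_trans (size_polyMleq _ _) _; rewrite size_polyXn.
    by rewrite addSn /=; apply: leq_trans (leq_add (leq_b1 _) sA) _.
  have yS : psum D y (pos D x).+1 = psum D y (pos D x) - z x.
    by rewrite psum_posS /z; case: x.2; rewrite ?opprK.
  rewrite comp_polyM comp_Xn_poly /A !yS.
  rewrite (rmorph_prod (comp_poly ('X + (z x)%:P))) /=.
  rewrite !big_mkcondl prod_pos_ltS mulrC /=; congr (_ * _).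
    apply: eq_bigr => v _; case: (e v) => //.
    by rewrite comp_polyB comp_polyX comp_polyC !raddfB /=; ring.
  by case: (e x); rewrite /= ?expr0 // expr1 !raddfB /=; ring.
move/(congr1 (fun p : {poly _} => p`_0)).
rewrite {1}/A psum_end coef0_prod (eq_bigl e) => [|x]; last first.
  by rewrite pos_ltn andbT.
rewrite (eq_bigr (fun x => psum D y (pos D x))) => [->|x _]; last first.
  by rewrite coefB coefX coefC sub0r opprB subr0.
by rewrite coef_sum; apply: eq_bigr => i _; rewrite coefZ /ladder_word A0.
Qed.

Definition picks n (D : chord_diagram n) (e : 'I_n * bool -> bool)
    (g : {ffun 'I_n * bool -> option 'I_n}) : bool :=
  [forall x, if g x is Some u then e x && live D x u else ~~ e x].

Definition picked n (g : {ffun 'I_n * bool -> option 'I_n}) (v : 'I_n) : nat :=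
  #|[set x | g x == Some v]|.

(** Compares coefficients of the monomial with exponents [d] in [prod_psum_ladder] for y = X. The
    signs come from the shifts by - X_v at left end-points. *)
Lemma count_picks n (D : chord_diagram n) (R : comNzRingType)
    (e : 'I_n * bool -> bool) (d : 'I_n -> nat) t :
  uniq t -> (forall x, x \in t) -> map (pos D) t = iota 0 n.*2 ->
  \sum_(g | picks D e g && [forall v, picked g v == d v]) 1 =
  \sum_(i : {ffun 'I_n * bool -> 'I_(n.*2.+3)}
          | [forall v, i (v, false) + i (v, true) == d v]%N)
    (\prod_v (-1) ^+ i (v, false)) * ladder_word R t e (fun x => i x) :> R.
Proof.
move=> ut tP tpos; pose X v : {mpoly R[n]} := 'X_v.
pose m := [multinom d v | v < n].
have mcoeff_m (k : 'X_{1.. n}) : ('X_[k])@_m = [forall v, k v == d v]%:R :> R.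
  rewrite mcoeffX; congr (nat_of_bool _)%:R; apply/eqP/forallP => [-> v|kd].
    by rewrite mnmE.
  by apply/mnmP => v; rewrite mnmE; apply/eqP.
have := congr1 (mcoeff m) (prod_psum_ladder X e ut tP tpos).
rewrite big_mkcond !raddf_sum /= => H.
(* [None] has weight 1 exactly where no pick is made, so that the sum over all options is the factor
   at x. *)
pose w x o : {mpoly R[n]} := if o is Some u then
  if e x && live D x u then X u else 0 else (~~ e x)%:R.
have wE x : \sum_o w x o = if e x then psum D X (pos D x) else 1.
  rewrite psum_live (bigD1 None) //= (reindex_omap Some id) => [|[u|] //].
  rewrite /w; case: (e x) => /=; last by rewrite big1 ?addr0.
  rewrite add0r [RHS]big_mkcond /= [LHS]big_mkcond.
  by apply: eq_bigr => u _; rewrite eqxx.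
have prodw (g : {ffun _}) : (\prod_x w x (g x))@_m =
    (picks D e g && [forall v, picked g v == d v])%:R :> R.
  have [gP|/forallPn[x]] := boolP (picks D e g); last first.
    rewrite (bigD1 x) //= /w; case: (g x) => [u|].
      by move/negPf->; rewrite mul0r mcoeff0.
    by rewrite negbK => ->; rewrite mul0r mcoeff0.
  pose k x := if g x is Some u then U_(u)%MM else 0%MM.
  rewrite (eq_bigr (fun x => 'X_[k x])) => [|x _]; last first.
    have := forallP gP x; rewrite /w /k; case: (g x) => [u ->|->] //.
    by rewrite mpolyX0.
  rewrite -(big_morph (fun m => 'X_[m]) (@mpolyXD n R) (@mpolyX0 n R)) mcoeff_m.
  congr (nat_of_bool _)%:R; apply: eq_forallb => v; congr (_ == _).
  rewrite mnm_sumE /picked -sum1_card [RHS]big_mkcond.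
  apply: eq_bigr => x _.
  rewrite inE /k; case: (g x) => [u|]; last by rewrite mnmE.
  by rewrite mnmE.
transitivity ((\prod_x \sum_o w x o)@_m).
  rewrite bigA_distr_bigA raddf_sum /= big_mkcond; apply: eq_bigr => g _.
  by rewrite prodw; case: ifP.
under eq_bigr do rewrite wE.
rewrite H [RHS]big_mkcond; apply: eq_bigr => i _.
have -> : \prod_x (if x.2 then X x.1 else - X x.1) ^+ i x =
  (\prod_v (-1) ^+ i (v, false))%:MP *
  'X_[[multinom (i (v, false) + i (v, true))%N | v < n]].
  rewrite prod_endpoints mpolyXE_id rmorph_prod -big_split.
  apply: eq_bigr => v _ /=; rewrite [(- X v) ^+ _]exprNn mnmE exprD !mulrA.
  by rewrite (rmorphXn (@mpolyC n R)) rmorphN rmorph1.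
rewrite -(ladder_word_map (@mpolyC n R)) mulrC mcoeffCM mcoeffCM mcoeff_m.
rewrite (eq_forallb (P2 := fun v => i (v, false) + i (v, true) == d v)%N).
  by case: ifP => _; rewrite ?mulr1 ?mulr0 // mulrC.
by move=> v; rewrite mnmE.
Qed.

(** * Thickened arcs as covering chords *)

Lemma lft_mono n (D : chord_diagram n) i j : (lft D i < lft D j)%N = (i < j)%N.
Proof.
apply/idP/idP => [|/lft_homo //]; apply: contraTT; rewrite -!leqNgt leq_eqVlt.
by case/predU1P => [/val_inj-> //|/(lft_homo D)/ltnW].
Qed.

(** A chord covering the right end of v is v itself, crosses v further right, or contains v: the
    loop, uncolored and red arcs leaving v. *)
Lemma live_rgt n (D : chord_diagram n) v u :
  live D (v, true) u = is_LID_arc D (v, u).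
Proof.
rewrite /live /is_LID_arc /intersecting /contained /pos /= -(lft_mono D).
have [->|vu] := eqVneq v u; first by rewrite leqnn lft_lt_rgt.
have := lft_lt_rgt D v; have := lft_lt_rgt D u.
have := lft_neq_rgt D u v; have := lft_neq_rgt D v u.
have : rgt D u != rgt D v by rewrite (inj_eq (@rgt_inj _ D)) eq_sym.
have : lft D v != lft D u :> nat by have := @pos_inj _ D (v, false) (u, false);
  rewrite /pos /=; case: eqP => // E /(_ E) [] /eqP; rewrite (negPf vu).
rewrite -!val_eqE /=; lia.
Qed.

(** Since v does not cover its own left end, there remain the uncolored arcs entering v and the
    reversals of red arcs leaving v. *)
Lemma live_lft n (D : chord_diagram n) v u :
  live D (v, false) u = (u < v)%N && intersecting D u v || contained D v u.
Proof.
rewrite /live /intersecting /contained /pos /= -(lft_mono D).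
have [->|vu] := eqVneq v u; first by rewrite ltnn.
have := lft_lt_rgt D v; have := lft_lt_rgt D u.
have := lft_neq_rgt D u v; have := lft_neq_rgt D v u.
have : rgt D u != rgt D v by rewrite (inj_eq (@rgt_inj _ D)) eq_sym.
have : lft D v != lft D u :> nat by have := @pos_inj _ D (v, false) (u, false);
  rewrite /pos /=; case: eqP => // E /(_ E) [] /eqP; rewrite (negPf vu).
rewrite -!val_eqE /=; lia.
Qed.

(** Read as an end-point of a chord: the right one if the initial segment is thickened, else the
    left one. *)
Definition endp (G : labeled_digraph) (k : thick_arc G) : vertex G * bool :=
  (thick_vertex k, thick_init k).

(** The chord picked at [endp k]. *)
Definition other (G : labeled_digraph) (k : thick_arc G) : vertex G :=
  if thick_init k then target k else source k.

(** Sorted by thickened segment, to match right and left end-points. As red arcs are no loops, their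
    thickening rule becomes a rule on reversal. *)
Lemma allowedE (G : labeled_digraph) (k : thick_arc G) :
  allowed k =
  if thick_init k then ~~ reversed k
  else if red (base k) then reversed k
  else ~~ reversed k && (init (base k) != term (base k)).
Proof.
rewrite /allowed /thick_vertex /source /target.
have := @red_nonloop _ (base k); case: (red (base k)) => [/(_ isT)|_].
  by move=> H; case: thick_init; case: reversed;
    rewrite ?eqxx // eq_sym (negPf H).
by case: thick_init; rewrite ?implybT ?andbT // implybF.
Qed.

Lemma allowed_live n (D : chord_diagram n) (k : thick_arc (LID D)) :
  allowed k -> live D (endp k) (other k).
Proof.
rewrite allowedE /endp /other /thick_vertex /source /target.
case: k => [[[[a b] ab] r] t]; rewrite /base /thick_init /reversed /=.
rewrite /LID_red /LID_init /LID_term /=.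
case: t => [|]; first by move/negPf->; rewrite live_rgt.
case: ifP => [ct ->|nct /andP[/negPf-> ne]]; rewrite live_lft ?ct ?orbT //.
by move: ab; rewrite /is_LID_arc /= (negPf ne) nct orbF /= => ->.
Qed.

Lemma live_allowed n (D : chord_diagram n) x u :
  live D x u ->
  exists2 k : thick_arc (LID D), allowed k & (endp k, other k) = (x, u).
Proof.
case: x => v [].
  rewrite live_rgt => vu.
  exists ((exist _ (v, u) vu : Defs.arc (LID D)), false, true) => //.
  by rewrite allowedE.
rewrite live_lft; have [ct _|nct] := boolP (contained D v u).
  have vu : is_LID_arc D (v, u) by rewrite /is_LID_arc ct !orbT.
  exists ((exist _ (v, u) vu : Defs.arc (LID D)), true, false) => //.
  by rewrite allowedE /= /LID_red /= ct.
rewrite orbF => uv.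
have vu : is_LID_arc D (u, v) by rewrite /is_LID_arc /= uv orbT.
exists ((exist _ (u, v) vu : Defs.arc (LID D)), false, false) => //.
rewrite allowedE /= /LID_red /LID_init /LID_term /=; case: ifP => [|_].
  case/andP: uv => + _ /and3P[]; rewrite -(lft_mono D) => /ltn_trans H + _ _.
  by move/H; rewrite ltnn.
by case/andP: uv => + _; apply: contraTneq => ->; rewrite ltnn.
Qed.

(** The only possible clash is between a reversed red arc and an uncolored arc thickened at its
    terminal segment; it cannot occur, since a contained chord does not cross its container. *)
Lemma endp_other_inj n (D : chord_diagram n) (k k' : thick_arc (LID D)) :
  allowed k -> allowed k' -> endp k = endp k' -> other k = other k' -> k = k'.
Proof.
rewrite !allowedE /endp /other /thick_vertex /source /target.
case: k => [[[[a b] ab] r] t]; case: k' => [[[[a' b'] ab'] r'] t'].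
rewrite /base /thick_init /reversed /= /LID_red /LID_init /LID_term /=.
have kE r0 t0 : a = a' -> b = b' ->
    (exist _ (a, b) ab : Defs.arc (LID D), r0, t0) =
    (exist _ (a', b') ab', r0, t0).
  by move=> aa' bb'; congr (_, _, _); apply: val_inj; rewrite /= aa' bb'.
have excl (p q : 'I_n) : contained D p q -> is_LID_arc D (q, p) ->
    contained D q p = false -> q != p -> False.
  rewrite /is_LID_arc /= => + + nc /negPf ne; rewrite nc ne orbF /=.
  move=> c /andP[_].
  by move: c; rewrite /contained /intersecting; lia.
move=> A A' [+ tt']; move: A A'; rewrite -{}tt'; case: t.
  by move=> /negPf-> /negPf->; apply: kE.
case: ifP => [ct ->|nct /andP[/negPf-> ne]];
  case: ifP => [ct' ->|nct' /andP[/negPf-> ne']].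
- by move=> aa' bb'; apply: kE.
- by move=> E E'; subst a' b'; case: (excl _ _ ct ab' nct' ne').
- by move=> E E'; subst a' b'; case: (excl _ _ ct' ab nct ne).
by move=> bb' aa'; apply: kE.
Qed.

(** * Acceptable collections as systems of picks *)

Definition active n (g : {ffun 'I_n * bool -> option 'I_n}) (v : 'I_n) : nat :=
  (g (v, false) != None) + (g (v, true) != None).

(** For acceptable [K] at most one arc sits at each end-point, so the choice is forced. *)
Definition picks_of n (D : chord_diagram n) (K : {set thick_arc (LID D)}) :
    {ffun 'I_n * bool -> option 'I_n} :=
  [ffun x => omap (@other _) [pick k in K | endp k == x]].

Definition arcs_of n (D : chord_diagram n)
    (g : {ffun 'I_n * bool -> option 'I_n}) : {set thick_arc (LID D)} :=
  [set k : thick_arc (LID D) | allowed k && (g (endp k) == Some (other k))].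

(** This boolean form is the side condition produced by [reindex_onto] in [J_picks]. *)
Lemma arcs_ofK n (D : chord_diagram n)
    (g : {ffun 'I_n * bool -> option 'I_n}) :
  (picks_of (arcs_of D g) == g) = picks D (fun x => g x != None) g.
Proof.
apply/eqP/forallP => [gE x|gP].
  case gx: (g x) => [u|] //; move: gx; rewrite -gE ffunE.
  case: pickP => //= k; rewrite inE => /andP[/andP[kP _] /eqP<-] [<-].
  exact: allowed_live.
apply/ffunP => x; rewrite ffunE; case: pickP => [k|none] /=.
  by rewrite inE => /andP[/andP[_ /eqP<-] /eqP->].
have := gP x; case gx: (g x) => [u|] //= /live_allowed[k kP [kx ku]].
by have := none k; rewrite inE kP kx gx ku !eqxx.
Qed.

Lemma endp_inj_arcs n (D : chord_diagram n)
    (g : {ffun 'I_n * bool -> option 'I_n}) :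
  {in arcs_of D g &, injective (@endp (LID D))}.
Proof.
move=> k k'; rewrite !inE => /andP[kP /eqP gk] /andP[kP' /eqP gk'] kk'.
by apply: endp_other_inj => //; move: gk; rewrite kk' gk' => -[].
Qed.

Lemma card_arcs n (D : chord_diagram n)
    (g : {ffun 'I_n * bool -> option 'I_n}) (Q : pred ('I_n * bool))
    (S : pred 'I_n) :
  picks D (fun x => g x != None) g ->
  #|[set k in arcs_of D g | Q (endp k) && S (other k)]| =
  #|[set x | if g x is Some u then Q x && S u else false]|.
Proof.
move=> /forallP gP; rewrite -(card_in_imset (f := @endp (LID D))); last first.
  by move=> k k' /setIdP[kg _] /setIdP[kg' _]; apply: endp_inj_arcs kg kg'.
apply: eq_card => x; rewrite inE; apply/imsetP/idP => [[k]|].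
  by rewrite !inE => /andP[/andP[_ /eqP gk] kQ] ->; rewrite gk.
have := gP x; case gx: (g x) => [u|] //= /live_allowed[k kP [kx ku]] QS.
by exists k; rewrite ?inE ?kx ?ku ?kP ?gx ?eqxx.
Qed.

Lemma degreeE (G : labeled_digraph) (K : {set thick_arc G}) v :
  degree K v = (#|thick_at K v| + #|[set k in K | other k == v]|)%N.
Proof.
have card P : #|[set k in K | P k]| = (\sum_(k in K) P k)%N.
  by rewrite -sum1dep_card big_mkcondr.
rewrite /thick_at !card -big_split; apply: eq_bigr => k _.
by rewrite /thick_vertex /other; case: ifP => _ //; rewrite addnC.
Qed.

Lemma card_endpoints n (A : {set 'I_n * bool}) :
  #|A| = (\sum_v (((v, false) \in A) + ((v, true) \in A)))%N.
Proof.
rewrite -sum1_card big_mkcond /= (eq_bigr (fun x => ((x.1, x.2) \in A : nat))).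
  rewrite -(pair_bigA _ (fun v b => ((v, b) \in A : nat))) /=.
  by apply: eq_bigr => v _; rewrite big_bool addnC.
by case=> v b _; case: ifP.
Qed.

Lemma card_thick_at n (D : chord_diagram n)
    (g : {ffun 'I_n * bool -> option 'I_n}) v :
  picks D (fun x => g x != None) g -> #|thick_at (arcs_of D g) v| = active g v.
Proof.
move=> gP; have := @card_arcs _ D g (fun x => x.1 == v) predT gP.
rewrite (eq_card (B := thick_at (arcs_of D g) v)) => [->|k]; last first.
  by rewrite !inE andbT.
rewrite card_endpoints (bigD1 v) //= big1 => [|w /negPf wv].
  rewrite !inE addn0 /active eqxx.
  by case: (g (v, false)); case: (g (v, true)).
by rewrite !inE wv; case: (g (w, false)); case: (g (w, true)).
Qed.

Lemma card_other_arcs n (D : chord_diagram n)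
    (g : {ffun 'I_n * bool -> option 'I_n}) v :
  picks D (fun x => g x != None) g ->
  #|[set k in arcs_of D g | other k == v]| = picked g v.
Proof.
move=> gP; have := @card_arcs _ D g predT (pred1 v) gP.
rewrite (eq_card (B := [set k in arcs_of D g | other k == v])) => [->|k].
  by apply: eq_card => x; rewrite !inE; case: (g x).
by rewrite !inE.
Qed.

Lemma init_count_arcs n (D : chord_diagram n)
    (g : {ffun 'I_n * bool -> option 'I_n}) :
  picks D (fun x => g x != None) g ->
  init_count (arcs_of D g) = (\sum_v (g (v, true) != None))%N.
Proof.
move=> gP; have := @card_arcs _ D g (fun x => x.2) predT gP.
rewrite (eq_card (B := [set k in arcs_of D g | thick_init k])) => [|k];
  last by rewrite !inE andbT.
rewrite /init_count => ->; rewrite card_endpoints; apply: eq_bigr => v _.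
by rewrite !inE; case: (g (v, false)); case: (g (v, true)).
Qed.

Lemma degree_arcs n (D : chord_diagram n)
    (g : {ffun 'I_n * bool -> option 'I_n}) v :
  picks D (fun x => g x != None) g ->
  degree (arcs_of D g) v = (active g v + picked g v)%N.
Proof. by move=> gP; rewrite degreeE card_thick_at // card_other_arcs. Qed.

(** Degrees are [active] plus [picked], so the half condition is their equality; the degree is then
    twice a number at most 2. Two arcs thickened at v in the same way would share an end-point. *)
Lemma acceptable_arcs n (D : chord_diagram n)
    (g : {ffun 'I_n * bool -> option 'I_n}) :
  picks D (fun x => g x != None) g ->
  acceptable (arcs_of D g) = [forall v, picked g v == active g v].
Proof.
move=> gP; rewrite /acceptable.
apply/and4P/forallP => [[_ _ /forallP gdeg _] v|gdeg].
  have := gdeg v; rewrite degree_arcs // card_thick_at // -addnn eqn_add2l.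
  by rewrite eq_sym.
split.
- by apply/forall_inP => k; rewrite inE => /andP[].
- apply/forallP => v; rewrite degree_arcs // (eqP (gdeg v)) /active.
  by case: (g (v, false)); case: (g (v, true)).
- apply/forallP => v; rewrite degree_arcs // card_thick_at // (eqP (gdeg v)).
  by rewrite addnn.
apply/forallP => v; apply/forall_inP => k /setIdP[kg /eqP kv].
apply/forall_inP => k' /setIdP[kg' /eqP kv'].
apply/implyP; apply: contra_neq => kk'.
by apply: endp_inj_arcs kg kg' _; rewrite /endp kv kv' kk'.
Qed.

(** The last clause of acceptability makes [endp] injective on [K]. *)
Lemma picks_ofK n (D : chord_diagram n) (K : {set thick_arc (LID D)}) :
  acceptable K -> arcs_of D (picks_of K) = K.
Proof.
case/and4P => /forall_inP Kallowed _ _ /forallP Kin.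
have K_inj : {in K &, injective (@endp (LID D))}.
  move=> k k' kK kK' [kv kt]; apply/eqP; apply: contraT => kk'.
  have /forall_inP/(_ k) := Kin (thick_vertex k).
  rewrite inE kK eqxx => /(_ isT).
  by move/forall_inP/(_ k'); rewrite inE kK' kv eqxx kk' kt eqxx => /(_ isT).
apply/setP => k; rewrite inE ffunE.
apply/andP/idP => [[ka]|kK].
  case: pickP => //= k' /andP[kK' /eqP kk'] /eqP[oo].
  by rewrite -(endp_other_inj (Kallowed _ kK') ka kk' oo).
split; first exact: Kallowed.
case: pickP => [k' /andP[kK' /eqP kk']|/(_ k)]; last by rewrite kK eqxx.
by rewrite (K_inj _ _ kK' kK kk').
Qed.

(** * J as a sum over systems of picks *)

(** Share of one chord in a term of J: a pick at the right end-point is an arc counted by a(K), and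
    degree 4 means that both end-points pick. *)
Definition vertex_weight (e1 e2 : bool) : {poly rat} :=
  (-1) ^+ e2 * (if e1 && e2 then 2%:R else 'X + 2%:R).

Lemma arcs_weight n (D : chord_diagram n)
    (g : {ffun 'I_n * bool -> option 'I_n}) :
  picks D (fun x => g x != None) g -> (forall v, picked g v = active g v) ->
  2%:R ^+ deg4 (arcs_of D g)
    * ('X + 2%:R) ^+ (#|{: vertex (LID D)}| - deg4 (arcs_of D g))
    * (-1) ^+ init_count (arcs_of D g)
  = \prod_v vertex_weight (g (v, false) != None) (g (v, true) != None).
Proof.
move=> gP gdeg; rewrite big_split /= init_count_arcs // mulrC; congr (_ * _).
  by rewrite (big_morph _ (exprD (-1)) (expr0 _)).
pose B := [set v | (g (v, false) != None) && (g (v, true) != None)].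
have -> : deg4 (arcs_of D g) = #|B|.
  apply: eq_card => v; rewrite !inE degree_arcs // gdeg addnn /active.
  by case: (g (v, false)); case: (g (v, true)).
have -> : (#|{: vertex (LID D)}| - #|B| = #|~: B|)%N.
  by rewrite -(cardsC B) addKn.
rewrite (bigID (mem B)) /= -!prodr_const; congr (_ * _).
  by apply: eq_bigr => v; rewrite inE => ->.
by apply: eq_big => v; rewrite !inE => // /negPf->.
Qed.

Lemma J_picks n (D : chord_diagram n) :
  (J (LID D)).@[fun _ => 1] =
  \sum_(e : {ffun 'I_n * bool -> bool})
    (\prod_v vertex_weight (e (v, false)) (e (v, true))) *
    \sum_(g | picks D e g &&
              [forall v, picked g v == e (v, false) + e (v, true)]%N) 1.
Proof.
rewrite /J raddf_sum /=.
transitivity (\sum_(g : {ffun 'I_n * bool -> option 'I_n} |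
    picks D (fun x => g x != None) g && [forall v, picked g v == active g v])
  \prod_v vertex_weight (g (v, false) != None) (g (v, true) != None)).
  rewrite (reindex_onto (arcs_of D) (@picks_of n D)) => [|K];
    last exact: picks_ofK.
  apply: eq_big => g; rewrite arcs_ofK.
    by rewrite andbC; apply: andb_id2l => gP; rewrite acceptable_arcs.
  case/andP => + gP; rewrite acceptable_arcs // => /forallP gdeg.
  rewrite !mevalM mevalC rmorphXn /= mevalN meval1.
  rewrite (big_morph _ (@mevalM _ _ _) (@meval1 _ _ _)) big1 ?mulr1.
    by apply: arcs_weight => // v; apply/eqP.
  by move=> k _; rewrite mevalXU.
(* The systems of picks are grouped by the set of end-points that pick. *)
pose supp (g : {ffun 'I_n * bool -> option 'I_n}) := [ffun x => g x != None].
rewrite (partition_big supp predT) //=; apply: eq_bigr => e _.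
rewrite mulr_sumr; apply: eq_big => [g|g /andP[_ /eqP<-]]; last first.
  by rewrite mulr1; apply: eq_bigr => v _; rewrite !ffunE.
apply/andP/andP => [[/andP[gP gdeg] /eqP<-]|[gP gdeg]].
  split; last by apply/forallP => v; rewrite !ffunE (forallP gdeg).
  by apply/forallP => x; have := forallP gP x; rewrite ffunE.
have ge x : (g x != None) = e x.
  by have := forallP gP x; case: (g x) => [u /andP[->]|/negPf->].
split; last by apply/eqP/ffunP => x; rewrite ffunE ge.
apply/andP; split.
  by apply/forallP => x; have := forallP gP x; rewrite ge.
by apply/forallP => v; have := forallP gdeg v; rewrite /active !ge.
Qed.

(** * Comparison of the two sums *)

Theorem theorem2 (n : nat) (D : chord_diagram n) :
  WJ D = (J (LID D)).@[fun _ => 1].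
Proof.
have [t [ut tP tpos]] := endpoints_sorted D.
rewrite (WJ_ladder n.*2 ut tP tpos) J_picks.
(* A choice of operators splits into the factors m ([e]), which mark the picking end-points, and the
   orders of derivation ([i]). *)
pose join
    (p : {ffun 'I_n * bool -> bool} * {ffun 'I_n * bool -> 'I_(n.*2.+3)}) :=
  [ffun x => (p.1 x, p.2 x)].
rewrite (reindex join) /=; last first.
  exists (fun h => ([ffun x => (h x).1], [ffun x => (h x).2])) => [[e i] _|h _].
    by congr (_, _); apply/ffunP => x; rewrite !ffunE.
  by apply/ffunP => x; rewrite !ffunE; case: (h x).
pose C e i := \prod_v pair_coef
  (join (e, i) (v, false)).1 (join (e, i) (v, true)).1
  (join (e, i) (v, false)).2 (join (e, i) (v, true)).2.
pose word e i := ladder_word {poly rat} t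
  (fun x => (join (e, i) x).1) (fun x => (join (e, i) x).2).
rewrite -(pair_bigA _ (fun e i => C e i * word e i)) /=.
apply: eq_bigr => e _.
rewrite (count_picks {poly rat} e (fun v => e (v, false) + e (v, true))%N
  ut tP tpos).
rewrite mulr_sumr big_mkcond [RHS]big_mkcond; apply: eq_bigr => i _ /=.
have -> : word e i = ladder_word {poly rat} t e (fun x => i x).
  rewrite /word /ladder_word; congr (_`_0).
  elim: t (1 : {poly _}) {word ut tP tpos} => //= x t IHt f.
  by rewrite IHt !ffunE.
(* [pair_coef] vanishes unless the two orders at v sum to its number of picks, the condition in
   [count_picks]. *)
rewrite {}/C; case: forallP => [deg|ndeg]; last first.
  have /existsP[v vP] :
      [exists v, i (v, false) + i (v, true) != e (v, false) + e (v, true)]%N.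
    apply: contraT => /existsPn H; case: ndeg => v.
    by have := H v; rewrite negbK.
  by rewrite (bigD1 v) //= /pair_coef !ffunE (negPf vP) !mul0r.
(* The sign (-1)^(e2+i1) splits between [vertex_weight] and the shifts at left end-points. *)
rewrite mulrA -big_split /=; congr (_ * _); apply: eq_bigr => v _.
rewrite /pair_coef /vertex_weight !ffunE (eqP (deg v)) eqxx exprD mul1r.
by rewrite mulrAC.
Qed.
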